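(* The following two statements are true: (1) Let $p$ be a prime, let $R$ be a weakly periodic ring with $p\cdot 1\in \mathrm{Nil}(R)$ and let $G$ be a locally finite $p$-group. Then the group ring $RG$ is weakly periodic. (2) Let $R$ be a ring and let $G$ be a nilpotent group. If the group ring $RG$ is weakly periodic, then $R$ is a weakly periodic ring and $G$ is a torsion group.
   Context: All rings are associative with identity $1\neq 0$ (not necessarily commutative). A ring is weakly periodic if each of its elements is a sum of a potent element and a nilpotent element (not required to commute), where $e$ is potent if $e^n=e$ for some integer $n\ge 2$. $\mathrm{Nil}(R)$ denotes the set of nilpotent elements of $R$. A group is locally finite if each of its finitely generated subgroups is finite. A torsion group is one in which every element has finite order. *)

(* Defs.v *)
From HB Require Import structures.
From mathcomp Require Import all_boot all_order all_algebra.
From mathcomp Require Import finmap monalg.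

Set Implicit Arguments.
Unset Strict Implicit.
Unset Printing Implicit Defensive.

Import GRing.Theory.
Local Open Scope ring_scope.

Section WeaklyPeriodic.
Variable A : nzRingType.

Definition potent (e : A) : Prop := exists2 n, (2 <= n)%N & e ^+ n = e.

Definition nilpotent_elt (x : A) : Prop := exists n, x ^+ n = 0.

Definition weakly_periodic : Prop :=
  forall a : A, exists e q : A, [/\ potent e, nilpotent_elt q & a = e + q].

End WeaklyPeriodic.

(* Groups are possibly infinite, so subsets and subgroups are Prop-valued. *)
Section GroupNotions.
Variable G : groupType.
Local Open Scope group_scope.

Definition is_subgroup (H : G -> Prop) : Prop :=
  [/\ H 1, forall x y, H x -> H y -> H (x * y) & forall x, H x -> H x^-1].

Definition generated (S : G -> Prop) (x : G) : Prop :=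
  forall H : G -> Prop, is_subgroup H -> (forall y, S y -> H y) -> H x.

Definition finite_subset (H : G -> Prop) : Prop :=
  exists s : seq G, forall x, H x -> x \in s.

Definition locally_finite : Prop :=
  forall s : seq G, finite_subset (generated (fun x => x \in s)).

Definition has_order (g : G) (n : nat) : Prop :=
  [/\ (0 < n)%N, g ^+ n = 1 & forall m, (0 < m)%N -> g ^+ m = 1 -> (n <= m)%N].

Definition torsion_group : Prop := forall g : G, exists n, has_order g n.

Definition p_group (p : nat) : Prop :=
  forall g : G, exists k, has_order g (p ^ k)%N.

(* The indexing starts at 0: the 0-th term is G itself, the next one [G, G]. *)
Fixpoint lower_central (n : nat) : G -> Prop :=
  if n is m.+1 then
    generated (fun z => exists x y, lower_central m x /\ z = [~ x, y])
  else fun=> True.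

Definition nilpotent_group : Prop :=
  exists n, forall x, lower_central n x -> x = 1.

End GroupNotions.

(* The group ring R[G]: its elements are those of {malg R[G]}, the finitely   *)
(* supported functions from G to R. The ring structure that monalg puts on    *)
(* {malg R[K]} requires that 1 be the only invertible element of K, whence    *)
(* the alias carrying the convolution product for a group.                    *)
Definition group_ring (R : nzRingType) (G : groupType) := {malg R[G]}.

Section GroupRing.
Variables (R : nzRingType) (G : groupType).
Implicit Types (u v w : group_ring R G) (c : R) (x y : G).

HB.instance Definition _ := GRing.Lmodule.copy (group_ring R G) {malg R[G]}.

Definition gr_one : group_ring R G := << 1 *g 1%g >>.

Definition gr_mul u v : group_ring R G :=
  \sum_(x <- msupp u) \sum_(y <- msupp v) << u@_x * v@_y *g (x * y)%g >>.

Lemma gr_mulw (d1 d2 : {fset G}) u v :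
  (msupp u `<=` d1)%fset -> (msupp v `<=` d2)%fset ->
  gr_mul u v =
    \sum_(x <- d1) \sum_(y <- d2) << u@_x * v@_y *g (x * y)%g >>.
Proof.
move=> le_d1 le_d2; rewrite /gr_mul (big_fset_incl _ le_d1) /=.
  apply/eq_bigr=> x _; apply/big_fset_incl => // y _ /mcoeff_outdom ->.
  by rewrite mulr0 monalgU0.
move=> x _ /mcoeff_outdom ux.
by rewrite big1 => // y _; rewrite ux mul0r monalgU0.
Qed.

Lemma gr_mulUU c1 c2 x y :
  gr_mul << c1 *g x >> << c2 *g y >> = << c1 * c2 *g (x * y)%g >>.
Proof. by rewrite (gr_mulw msuppU_le msuppU_le) !big_seq_fset1 !mcoeffUU. Qed.

Lemma gr_mulDl : left_distributive gr_mul +%R.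
Proof.
move=> u v w; have sD := msuppD_le u v.
rewrite (gr_mulw sD (fsubset_refl _)).
rewrite (gr_mulw (fsubsetUl (msupp u) (msupp v)) (fsubset_refl _)).
rewrite (gr_mulw (fsubsetUr (msupp u) (msupp v)) (fsubset_refl _)).
rewrite -big_split /=; apply/eq_bigr=> x _.
rewrite -big_split /=; apply/eq_bigr=> y _.
by rewrite mcoeffD mulrDl monalgUD.
Qed.

Lemma gr_mulDr : right_distributive gr_mul +%R.
Proof.
move=> w u v; have sD := msuppD_le u v.
rewrite (gr_mulw (fsubset_refl _) sD).
rewrite (gr_mulw (fsubset_refl _) (fsubsetUl (msupp u) (msupp v))).
rewrite (gr_mulw (fsubset_refl _) (fsubsetUr (msupp u) (msupp v))).
rewrite -big_split /=; apply/eq_bigr=> x _.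
rewrite -big_split /=; apply/eq_bigr=> y _.
by rewrite mcoeffD mulrDr monalgUD.
Qed.

Lemma gr_mul0r : left_zero 0 gr_mul.
Proof. by move=> u; rewrite /gr_mul msupp0 big_seq_fset0. Qed.

Lemma gr_mulr0 : right_zero 0 gr_mul.
Proof.
by move=> u; rewrite /gr_mul big1 // => x _; rewrite msupp0 big_seq_fset0.
Qed.

Lemma gr_mul_suml I (r : seq I) (F : I -> group_ring R G) v :
  gr_mul (\sum_(i <- r) F i) v = \sum_(i <- r) gr_mul (F i) v.
Proof. exact: (big_morph (gr_mul^~ v) (fun a b => gr_mulDl a b v) (gr_mul0r v)). Qed.

Lemma gr_mul_sumr I (r : seq I) (F : I -> group_ring R G) u :
  gr_mul u (\sum_(i <- r) F i) = \sum_(i <- r) gr_mul u (F i).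
Proof. exact: (big_morph (gr_mul u) (gr_mulDr u) (gr_mulr0 u)). Qed.

Lemma gr_E u : u = \sum_(x <- msupp u) (<< u@_x *g x >> : group_ring R G).
Proof. exact: monalgE. Qed.

Lemma gr_mul1g : left_id gr_one gr_mul.
Proof.
move=> u; rewrite [in LHS](gr_E u) [RHS]gr_E gr_mul_sumr.
by apply/eq_bigr => x _; rewrite gr_mulUU mul1r mul1g.
Qed.

Lemma gr_mulg1 : right_id gr_one gr_mul.
Proof.
move=> u; rewrite [in LHS](gr_E u) [RHS]gr_E gr_mul_suml.
by apply/eq_bigr => x _; rewrite gr_mulUU mulr1 mulg1.
Qed.

Lemma gr_mulA : associative gr_mul.
Proof.
move=> u v w; rewrite (gr_E u) !gr_mul_suml; apply/eq_bigr => x _.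
rewrite (gr_E v) gr_mul_sumr !gr_mul_suml gr_mul_sumr; apply/eq_bigr => y _.
rewrite (gr_E w) !gr_mul_sumr; apply/eq_bigr => z _.
by rewrite !gr_mulUU mulrA mulgA.
Qed.

Lemma gr_one_neq0 : gr_one != 0.
Proof. by rewrite /gr_one monalgU_eq0 oner_eq0. Qed.

HB.instance Definition _ := GRing.Zmodule_isNzRing.Build (group_ring R G)
  gr_mulA gr_mul1g gr_mulg1 gr_mulDl gr_mulDr gr_one_neq0.

End GroupRing.

(* Main.v *)
(* (1) R embeds in RG and splits the augmentation, so it suffices that every  *)
(* element of RG with nilpotent augmentation is nilpotent; the support being  *)
(* finite, G may be taken finite. Let z be central of order p: z - 1 is       *)
(* nilpotent because (z - 1)^p is a multiple of p, and it generates the       *)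
(* kernel of RG -> R[G/<z>], so induction on #|G| applies.                    *)
(* (2) R is an image of RG. If z is central in G and z = e + q with e^n = e   *)
(* and q nilpotent, then e, q and z commute, so z^n - z, hence z^(n-1) - 1,   *)
(* is nilpotent, which forces z to have finite order. Applied to G modulo the *)
(* terms of its lower central series, this shows by descending induction that *)
(* each term is torsion.                                                      *)
Require Import Defs.
From HB Require Import structures.
From mathcomp Require Import all_boot all_order all_algebra.
From mathcomp Require Import all_fingroup all_solvable.
From mathcomp Require Import finmap monalg boolp.

Set Implicit Arguments.
Unset Strict Implicit.
Unset Printing Implicit Defensive.

Import Defs GRing.Theory.
Local Open Scope ring_scope.

(** Two mechanisms carry the sketch above. For (1), idempotent-like data come from [R]: write the
    augmentation of [u] as a potent [e] plus a nilpotent, keep [e] as a constant, and what remains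
    has nilpotent augmentation. [nilpotent_of_aug] makes it nilpotent by reducing to the finite case
    [nilpotent_of_aug_finite], which rests on [gr_map_ker] and [nilpotent_sub1]. For (2), weak
    periodicity passes to images of [RG], in particular to [R] and to group rings of quotients of
    [G]. [torsion_central] bounds the order of a central element, and [torsion_lower_central] climbs
    the lower central series with it. *)

(** * Ring morphisms out of a group ring *)

Section GroupRingMorphism.
Variables (R A : nzRingType) (G : groupType).
Variables (i : {rmorphism R -> A}) (h : G -> A).
Hypothesis h_monoid : h 1%g = 1 /\ {morph h : x y / (x * y)%g >-> x * y}.
Hypothesis h_comm : forall c x, GRing.comm (h x) (i c).

Let lift (u : group_ring R G) : A := mmap i h u.

Lemma gr_liftU c x : lift << c *g x >> = i c * h x.
Proof. exact: mmapU. Qed.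

(** The universal property of the group ring, with noncommutative coefficients: products of
    monomials are preserved because [h x] can be moved past [i c]. It serves both the augmentation
    and [gr_map]. *)
Lemma gr_lift_is_monoid_morphism : monoid_morphism lift.
Proof.
have [h1 hM] := h_monoid.
have lift_sum (F : G -> group_ring R G) (s : seq G) :
  lift (\sum_(x <- s) F x) = \sum_(x <- s) lift (F x) by exact: raddf_sum.
split=> [|u v]; first by rewrite gr_liftU rmorph1 h1 mulr1.
rewrite [in RHS](gr_E u) [in RHS](gr_E v) !lift_sum mulr_suml.
apply: eq_bigr => x _; rewrite lift_sum mulr_sumr.
apply: eq_bigr => y _; rewrite !gr_liftU rmorphM hM.
by rewrite -mulrA [i _ * (h x * _)]mulrA -h_comm !mulrA.
Qed.

End GroupRingMorphism.

Lemma gr_additive_ext (R : nzRingType) (G : groupType) (B : zmodType)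
    (f g : {additive group_ring R G -> B}) :
  (forall c x, f << c *g x >> = g << c *g x >>) -> f =1 g.
Proof.
by move=> fg u; rewrite (gr_E u) !raddf_sum; apply: eq_bigr => x _.
Qed.

(** * The augmentation, and the copies of [R] and [G] inside [RG] *)

Section Morphisms.
Variables (R : nzRingType) (G : groupType).

Definition aug (u : group_ring R G) : R := mmap (@idfun R) (fun=> 1) u.

Lemma aug_is_additive : additive aug.
Proof. exact: raddfB. Qed.
HB.instance Definition _ := GRing.isAdditive.Build (group_ring R G) R aug
  aug_is_additive.

Lemma aug_is_monoid_morphism : monoid_morphism aug.
Proof.
apply: gr_lift_is_monoid_morphism => [|c x]; last exact/commr_sym/commr1.
by split=> // x y; rewrite mulr1.
Qed.
HB.instance Definition _ := GRing.isMonoidMorphism.Build (group_ring R G) R aug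
  aug_is_monoid_morphism.

Lemma augU c x : aug << c *g x >> = c.
Proof. by rewrite /aug mmapU mulr1. Qed.

Definition gr_const (c : R) : group_ring R G := << c *g 1%g >>.

Lemma gr_const_is_additive : additive gr_const.
Proof. exact: monalgUB. Qed.
HB.instance Definition _ := GRing.isAdditive.Build R (group_ring R G) gr_const
  gr_const_is_additive.

Lemma gr_const_is_monoid_morphism : monoid_morphism gr_const.
Proof. by split=> // c d; rewrite [RHS]gr_mulUU mulg1. Qed.
HB.instance Definition _ := GRing.isMonoidMorphism.Build R (group_ring R G) gr_const
  gr_const_is_monoid_morphism.

Definition gr_of (x : G) : group_ring R G := << 1 *g x >>.

Lemma gr_of1 : gr_of 1%g = 1. Proof. by []. Qed.

Lemma gr_ofM : {morph gr_of : x y / (x * y)%g >-> x * y}.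
Proof. by move=> x y; rewrite [RHS]gr_mulUU mulr1. Qed.

Lemma gr_ofX x n : gr_of (x ^+ n)%g = gr_of x ^+ n.
Proof. by elim: n => // n IHn; rewrite expgS exprS gr_ofM IHn. Qed.

Lemma gr_const_of c x : gr_const c * gr_of x = << c *g x >>.
Proof. by rewrite [LHS]gr_mulUU mulr1 mul1g. Qed.

Lemma gr_const_comm c x : GRing.comm (gr_of x) (gr_const c).
Proof. by rewrite /GRing.comm gr_const_of [LHS]gr_mulUU mul1r mulg1. Qed.

Lemma gr_of_central z :
  (forall x : G, commute z x) -> forall u, GRing.comm (gr_of z) u.
Proof.
move=> zC u; rewrite (gr_E u); apply: commr_sum => x _.
rewrite -gr_const_of; apply: commrM; first exact: gr_const_comm.
by rewrite /GRing.comm -!gr_ofM zC.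
Qed.

Lemma augK : cancel gr_const aug.
Proof. by move=> c; rewrite augU. Qed.

End Morphisms.

(** * Functoriality in the group *)

Section Functoriality.
Variable R : nzRingType.

(** [f] is an arbitrary function, so that set-theoretic sections can be applied too; the map is
    additive in general, and multiplicative when [f] is a morphism. *)
Definition gr_map (G H : groupType) (f : G -> H) (u : group_ring R G) :
  group_ring R H := mmap (@gr_const R H) (fun x => gr_of R (f x)) u.

Lemma gr_mapE (G H : groupType) (f : G -> H) u :
  gr_map f u = \sum_(x <- msupp u) (<< u@_x *g f x >> : group_ring R H).
Proof. by apply: eq_bigr => x _; rewrite gr_const_of. Qed.

Lemma gr_map_is_additive (G H : groupType) (f : G -> H) : additive (gr_map f).
Proof. exact: raddfB. Qed.
HB.instance Definition _ (G H : groupType) (f : G -> H) :=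
  GRing.isAdditive.Build (group_ring R G) (group_ring R H) (gr_map f)
    (gr_map_is_additive f).

Lemma gr_mapU (G H : groupType) (f : G -> H) c x :
  gr_map f << c *g x >> = << c *g f x >>.
Proof. by rewrite -[RHS]gr_const_of; exact: mmapU. Qed.

Lemma gr_map_is_monoid_morphism (G H : groupType)
  (f : UMagmaMorphism.type G H) : monoid_morphism (gr_map f).
Proof.
apply: gr_lift_is_monoid_morphism => [|c x]; last exact: gr_const_comm.
by split=> [|x y]; rewrite ?gmulf1 ?gr_of1// gmulfM gr_ofM.
Qed.
HB.instance Definition _ (G H : groupType)
    (f : UMagmaMorphism.type G H) :=
  GRing.isMonoidMorphism.Build (group_ring R G) (group_ring R H) (gr_map f)
    (gr_map_is_monoid_morphism f).

Lemma gr_map_comp (G H K : groupType) (f : G -> H) (g : H -> K) u :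
  gr_map g (gr_map f u) = gr_map (g \o f) u.
Proof.
by apply: (gr_additive_ext (f := gr_map g \o gr_map f) (g := gr_map (g \o f))) => c x /=;
  rewrite !gr_mapU.
Qed.

Lemma gr_map_id (G : groupType) (f : G -> G) u :
  {in msupp u, f =1 id} -> gr_map f u = u.
Proof.
move=> f_id; rewrite gr_mapE [RHS]gr_E.
by apply: eq_big_seq => x /f_id ->.
Qed.

Lemma aug_map (G H : groupType) (f : G -> H) u : aug (gr_map f u) = aug u.
Proof.
by apply: (gr_additive_ext (f := @aug R H \o gr_map f) (g := @aug R G)) => c x /=;
  rewrite gr_mapU !augU.
Qed.

End Functoriality.

(** * Nilpotent elements in a noncommutative ring *)

Section Nilpotents.
Variable A : nzRingType.
Implicit Types x y z : A.

Lemma nilpotent_exp x n : nilpotent_elt (x ^+ n) -> nilpotent_elt x.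
Proof. by case=> m xnm; exists (n * m)%N; rewrite exprM. Qed.

Lemma nilpotent_commM x y :
  GRing.comm x y -> nilpotent_elt x -> nilpotent_elt (x * y).
Proof. by move=> xy [n xn]; exists n; rewrite exprMn_comm// xn mul0r. Qed.

(** Put [t = z - 1] and expand [(1 + t) ^+ p = 1]: the inner binomial coefficients are divisible by
    [p], so [t ^+ p] is a multiple of the central nilpotent [p%:R]. *)
Lemma nilpotent_sub1 p z : prime p -> nilpotent_elt (p%:R : A) ->
  z ^+ p = 1 -> nilpotent_elt (z - 1).
Proof.
case: p => // p p_pr p_nil zp; set t := z - 1.
pose s := \sum_(i < p) (t ^+ i.+1) *+ ('C(p.+1, i.+1) %/ p.+1).
have tp : t ^+ p.+1 = p.+1%:R * - s.
  have : (1 + t) ^+ p.+1 = 1 by rewrite addrC subrK.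
  rewrite exprDn_comm; last exact/commr_sym/commr1.
  rewrite big_ord_recl big_ord_recr /= binn bin0 subnn !expr1n !mul1r !mulr1n.
  move/eqP; rewrite -subr_eq0 [1 + _]addrC addrK addr_eq0 => /eqP.
  rewrite /bump /= add1n => tp.
  rewrite -[LHS]opprK -tp mulrN; congr (- _).
  rewrite /s mulr_sumr; apply: eq_bigr => i _.
  rewrite expr1n mul1r mulr_natl -mulrnA divnK//.
  by apply: prime_dvd_bin => //=; rewrite ltnS.
case: p_nil => m pm; exists (p.+1 * m)%N.
by rewrite exprM tp exprMn_comm ?pm ?mul0r//; exact/commr_sym/commr_nat.
Qed.

End Nilpotents.

Lemma weakly_periodic_image (A B : nzRingType) (f : {rmorphism A -> B}) :
  (forall b, exists a, f a = b) -> weakly_periodic A -> weakly_periodic B.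
Proof.
move=> f_surj wpA b; have [a <-] := f_surj b.
have [e [q [[n n_gt1 en] [m qm] ->]]] := wpA a.
exists (f e), (f q); split; last exact: rmorphD.
  by exists n; rewrite // -rmorphXn en.
by exists m; rewrite -rmorphXn qm rmorph0.
Qed.

(** * Nilpotent augmentation over a finite p-group *)

Section AugmentationNil.
Variable R : nzRingType.

(** Moving each support element [x] to a fixed representative [y] of its fibre changes the monomial
    by [c * (z ^+ i - 1) * y], a multiple of [z - 1]; if [u] maps to 0, the moved element
    vanishes. *)
Lemma gr_map_ker (G H : groupType) (f : G -> H) (z : G) :
  (forall x y, f x = f y -> exists i, x = (z ^+ i * y)%g) ->
  forall u : group_ring R G, gr_map f u = 0 ->
  exists v, u = (gr_of R z - 1) * v.
Proof.
move=> f_ker u fu0.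
have [s sK] : exists s : H -> G, forall x, f (s (f x)) = f x.
  suff /choice[s sP] : forall h, exists y, forall x, f x = h -> f y = h.
    by exists s => x; exact: sP.
  move=> h; have [[x fx]|nfx] := EM (exists x, f x = h); first by exists x.
  by exists 1%g => x fx; case: nfx; exists x.
have -> : u = u - gr_map (s \o f) u by rewrite -gr_map_comp fu0 raddf0 subr0.
rewrite {1}(gr_E u) gr_mapE -sumrB.
elim/big_ind: _ => [|_ _ [v ->] [w ->]|x _].
- by exists 0; rewrite mulr0.
- by exists (v + w); rewrite mulrDr.
have [i xE] := f_ker x (s (f x)) (esym (sK x)).
rewrite -!gr_const_of -mulrBr {2}xE gr_ofM gr_ofX.
rewrite -{2}[gr_of R (s _)]mul1r -mulrBl subrX1 !mulrA.
have <- : GRing.comm (gr_of R z - 1) (gr_const G u@_x).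
  by apply/commr_sym/commrB; [exact/commr_sym/gr_const_comm | exact: commr1].
by rewrite -!mulrA; eexists.
Qed.

Lemma nilpotent_of_aug_finite (p : nat) (gT : finGroupType) :
  prime p -> nilpotent_elt (p%:R : R) -> (p.-group [set: gT])%g ->
  forall u : group_ring R gT, nilpotent_elt (aug u) -> nilpotent_elt u.
Proof.
move=> p_pr [m pm0].
have p_nil (G : groupType) : nilpotent_elt (p%:R : group_ring R G).
  by exists m; rewrite -(rmorph_nat (@gr_const R G)) -rmorphXn /= pm0 raddf0.
have [n] := ubnP #|gT|; elim: n gT => // n IHn gT le_gT pG u aug_u.
(* Over the trivial group [u] is the constant [aug u]. *)
have [G1|nt_G] := eqVneq [set: gT] 1%g.
  have -> : u = gr_const gT (aug u).
    apply: (gr_additive_ext (f := idfun) (g := @gr_const R gT \o @aug R gT)).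
    move=> c x /=; rewrite augU /gr_const.
    by have /set1gP-> : x \in [1 gT]%g by rewrite -G1 inE.
  by case: aug_u => k uk0; exists k; rewrite -rmorphXn /= uk0 raddf0.
have nt_Z : 'Z([set: gT])%g != 1%g by rewrite center_nil_eq1 ?(pgroup_nil pG).
have [_ p_Z _] := pgroup_pdiv (pgroupS (center_sub _) pG) nt_Z.
have [z Zz oz] := Cauchy p_pr p_Z.
have zC (x : gT) : commute z x by have /centerP[_] := Zz; apply; rewrite inE.
have nzN : normal <[z]>%g [set: gT] by rewrite sub_center_normal ?cycle_subG.
have in_norm x : x \in 'N(<[z]>)%g by rewrite (subsetP (normal_norm nzN)).
have fM : monoid.monoid_morphism (coset <[z]>%g).
  by split=> [|x y]; [exact: morph1 | rewrite morphM].
pose f : UMagmaMorphism.type gT (coset_of <[z]>%g) :=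
  HB.pack (coset <[z]>%g : gT -> _)
    (isUMagmaMorphism.Build gT (coset_of <[z]>%g) (coset <[z]>%g) fM).
have [k fuk] : nilpotent_elt (gr_map f u).
  apply: IHn; rewrite ?aug_map -?quotientT ?quotient_pgroup//.
  rewrite -cardsT -quotientT (leq_trans (ltn_quotient _ _)) ?subsetT//.
    by rewrite cycle_eq1 -order_eq1 oz neq_ltn prime_gt1 ?orbT.
  by rewrite cardsT -ltnS.
have f_ker x y : f x = f y -> exists i, x = (z ^+ i * y)%g.
  move/(rcoset_kercosetP (in_norm x) (in_norm y))/rcosetP => [_ /cycleP[i ->]].
  by exists i.
(* By induction [u ^+ k] dies in the quotient by the central [z], hence is a multiple of [z - 1],
   which is central and nilpotent. *)
apply: (@nilpotent_exp _ u k).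
have [v ->] : exists v, u ^+ k = (gr_of R z - 1) * v.
  by apply: (gr_map_ker f_ker); rewrite -fuk; exact: rmorphXn.
apply: nilpotent_commM.
  by apply/commr_sym/commrB; [exact/commr_sym/gr_of_central | exact: commr1].
apply: (nilpotent_sub1 p_pr (p_nil _)).
by rewrite -gr_ofX -oz expg_order.
Qed.

End AugmentationNil.

(** * Finite subgroups and quotients as group types *)

Section Subgroups.
Variable G : groupType.

Lemma generated_subgroup (S : G -> Prop) : is_subgroup (generated S).
Proof.
split=> [H [] //|x y Sx Sy H subH SH|x Sx H subH SH]; have [_ HM HV] := subH.
  by apply: HM; [exact: Sx | exact: Sy].
by apply: HV; exact: Sx.
Qed.

Lemma mem_generated (S : G -> Prop) x : S x -> generated S x.
Proof. by move=> Sx H _; exact. Qed.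

Lemma lower_central_subgroup n : is_subgroup (@lower_central G n).
Proof. by case: n => [|n]; [split | exact: generated_subgroup]. Qed.

Lemma lower_centralJ n (x y : G) :
  lower_central n x -> lower_central n (x ^ y)%g.
Proof.
elim: n x => // n IHn x Lx H subH SH.
have [H1 HM HV] := subH.
(* The elements whose conjugate by [y] lies in [H] form a subgroup containing the generating
   commutators. *)
apply: (Lx (fun z => H (z ^ y)%g)) => [|_ [a [b [La ->]]]]; last first.
  apply: SH; exists (a ^ y)%g, (b ^ y)%g; split; first exact: IHn.
  by rewrite conjRg.
split=> [|a b Ha Hb|a Ha]; first by rewrite conj1g.
  by rewrite conjMg; exact: HM.
by rewrite conjVg; exact: HV.
Qed.

(** Gives access to the theory of finite groups (Cauchy, centers of p-groups) from a subgroup of a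
    possibly infinite group. *)
Lemma finite_subgroup_morphism (H : G -> Prop) :
  is_subgroup H -> finite_subset H ->
  exists (gT : finGroupType) (f : UMagmaMorphism.type gT G),
    injective f /\ forall x, H x -> exists y, f y = x.
Proof.
move=> [H1 HM HV] [s Hs]; pose t := [seq x <- s | `[<H x>]].
have tP x : reflect (H x) (x \in t).
  rewrite mem_filter; apply: (iffP andP) => [[/asboolP]//|Hx].
  by split; [exact/asboolP | exact: Hs].
have tM (x y : seq_sub t) : (val x * val y)%g \in t.
  by apply/tP/HM; apply/tP; exact: valP.
have tV (x : seq_sub t) : (val x)^-1%g \in t by apply/tP/HV/tP; exact: valP.
have t1 : 1%g \in t by exact/tP.
pose mul x y : seq_sub t := SeqSub (tM x y).
have mulA : associative mul by move=> x y z; apply/val_inj/mulgA.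
have mul1 : left_id (SeqSub t1) mul by move=> x; apply/val_inj/mul1g.
have mulV : left_inverse (SeqSub t1) (fun x => SeqSub (tV x)) mul.
  by move=> x; apply/val_inj/mulVg.
pose gT : finGroupType :=
  HB.pack (seq_sub t) (Finite_isGroup.Build (seq_sub t) mulA mul1 mulV).
have fM : monoid.monoid_morphism (val : gT -> G) by [].
pose f : UMagmaMorphism.type gT G :=
  HB.pack (val : gT -> G) (isUMagmaMorphism.Build gT G (val : gT -> G) fM).
exists gT, f; split=> [|x /tP tx]; first exact: val_inj.
by exists (SeqSub tx).
Qed.

(** The quotient is carried by canonical representatives: [r x] is chosen in the coset [xN] and
    depends only on that coset, so cosets correspond to the fixed points of [r]. *)
Lemma quotient_morphism (N : G -> Prop) :
  is_subgroup N -> (forall x y, N x -> N (x ^ y)%g) ->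
  exists (Q : groupType) (f : UMagmaMorphism.type G Q),
    (forall q, exists x, f x = q) /\ forall x, f x = 1%g <-> N x.
Proof.
move=> [N1 NM NV] NJ; pose e (x y : G) := `[<N (x^-1 * y)%g>].
pose r x := choose (e x) x.
have eE x y : N (x^-1 * y)%g -> e x =1 e y.
  move=> xy z; apply: asbool_equiv_eq; split=> [xz|yz].
    by rewrite -[z](mulVKg x) mulgA -[(_ * x)%g]invgK invMg invgK; apply/NM/xz/NV.
  by rewrite -[z](mulVKg y) mulgA; exact: NM.
have exx x : e x x by apply/asboolP; rewrite mulVg.
have e_r x : N (x^-1 * r x)%g by apply/asboolP; exact: (chooseP (exx x)).
have r_e x : N ((r x)^-1 * x)%g.
  by rewrite -[X in (_ * X)%g]invgK -invMg; exact/NV/e_r.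
have rP x y : r x = r y <-> N (x^-1 * y)%g.
  split=> [rxy|xy].
    rewrite -[y](mulVKg (r y)) -{1}rxy mulgA; apply: NM; first exact: e_r.
    exact: r_e.
  rewrite /r (eq_choose (eE x y xy)); apply: choose_id => //.
  by rewrite -(eE x y xy).
have rr x : r (r x) == r x by apply/eqP/esym/rP.
pose Q := {x | r x == x}.
pose f x : Q := exist _ (r x) (rr x).
have f_surj (q : Q) : f (val q) = q by apply/val_inj/eqP/(valP q).
have feq x y : f x = f y <-> N (x^-1 * y)%g.
  by rewrite -rP; split=> [[]//|xy]; exact: val_inj.
pose mul (x y : Q) := f (val x * val y)%g.
have mulE x y : mul (f x) (f y) = f (x * y)%g.
  apply/feq; suff -> : ((r x * r y)^-1 * (x * y) =
      (r y)^-1 * y * ((r x)^-1 * x) ^ y)%g by exact/NM/NJ/r_e/r_e.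
  by rewrite invMg conjgE -!mulgA mulVKg.
pose inv (x : Q) := f (val x)^-1%g.
have invE x : inv (f x) = f x^-1%g.
  apply/feq; rewrite invgK.
  suff -> : (r x * x^-1 = (x^-1 * r x) ^ x^-1)%g by exact/NJ/e_r.
  by rewrite conjgE invgK -mulgA mulVKg.
have mulA : associative mul.
  move=> a b c; rewrite -(f_surj a) -(f_surj b) -(f_surj c) !mulE mulgA.
  by [].
have mul1 : left_id (f 1%g) mul.
  by move=> a; rewrite -(f_surj a) mulE mul1g.
have mulr1 : right_id (f 1%g) mul.
  by move=> a; rewrite -(f_surj a) mulE mulg1.
have mulV : left_inverse (f 1%g) inv mul.
  by move=> a; rewrite -(f_surj a) invE mulE mulVg.
have mulrV : right_inverse (f 1%g) inv mul.
  by move=> a; rewrite -(f_surj a) invE mulE mulgV.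
pose Qg : groupType := HB.pack Q (isGroup.Build Q mulA mul1 mulr1 mulV mulrV).
have fM : monoid.monoid_morphism (f : G -> Qg).
  by split=> // x y; rewrite [RHS]mulE.
pose fm : UMagmaMorphism.type G Qg :=
  HB.pack (f : G -> Qg) (isUMagmaMorphism.Build G Qg (f : G -> Qg) fM).
exists Qg, fm; split=> [q|x]; first by exists (val q); exact: f_surj.
have -> : 1%g = fm 1%g by [].
by rewrite [_ = _]feq mulg1; split=> /NV; rewrite ?invgK.
Qed.

End Subgroups.

Lemma has_order_torsion (G : groupType) (g : G) n :
  (0 < n)%N -> (g ^+ n = 1)%g -> exists m, has_order g m.
Proof.
move=> n_gt0 gn1; pose P m := (0 < m)%N && (g ^+ m == 1)%g.
have exP : exists m, P m by exists n; rewrite /P n_gt0 gn1 eqxx.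
exists (ex_minn exP); case: ex_minnP => m /andP[m_gt0 /eqP gm1] m_min.
by split=> // k k_gt0 /eqP gk1; apply: m_min; rewrite /P k_gt0.
Qed.

(** * Locally finite p-groups *)

Section LocallyFinite.
Variables (R : nzRingType) (G : groupType) (p : nat).
Hypotheses (p_pr : prime p) (p_nil : nilpotent_elt (p%:R : R)).
Hypotheses (G_lf : locally_finite G) (G_p : p_group G p).

(** The support of [u] generates a finite subgroup, so [u] comes from the group ring of a finite
    p-group. *)
Lemma nilpotent_of_aug (u : group_ring R G) :
  nilpotent_elt (aug u) -> nilpotent_elt u.
Proof.
move=> aug_u; pose H := generated (fun x => x \in enum_fset (msupp u)).
have [gT [f [f_inj f_surj]]] :=
  finite_subgroup_morphism (generated_subgroup _) (G_lf (enum_fset (msupp u))).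
have [g gK] : exists g : G -> gT, {in msupp u, cancel g f}.
  suff /choice[g gP] : forall x, exists y, x \in msupp u -> f y = x by exists g.
  move=> x; have [xu|nxu] := boolP (x \in msupp u); last by exists 1%g.
  by have [|y] := f_surj x; [exact: mem_generated | exists y].
(* For a prime [q] dividing the order of [gT], Cauchy gives [x] of order [q]; as [f] is injective,
   [q] divides the order [p ^ k] of [f x]. *)
have pgT : (p.-group [set: gT])%g.
  apply/pgroupP => q q_pr /(Cauchy q_pr)[x _ ox].
  have [k [_ fxk _]] := G_p (f x).
  have : (q %| p ^ k)%N.
    by rewrite -ox order_dvdn; apply/eqP/f_inj; rewrite gmulfXn fxk gmulf1.
  by rewrite Euclid_dvdX // dvdn_prime2 // => /andP[].
have [|k gu0] := nilpotent_of_aug_finite p_pr p_nil pgT (u := gr_map g u).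
  by rewrite aug_map.
exists k; rewrite -[u](gr_map_id (f := f \o g))// -gr_map_comp.
by rewrite -rmorphXn /= gu0 raddf0.
Qed.

Lemma group_ring_weakly_periodic :
  weakly_periodic R -> weakly_periodic (group_ring R G).
Proof.
move=> wpR u; have [e [q [[n n_gt1 en] q_nil aug_u]]] := wpR (aug u).
exists (gr_const G e), (u - gr_const G e); split; last by rewrite addrC subrK.
  by exists n => //; rewrite -rmorphXn en.
by apply: nilpotent_of_aug; rewrite raddfB /= augK aug_u [e + q]addrC addrK.
Qed.

End LocallyFinite.

(** * Nilpotent groups *)

Section NilpotentGroup.
Variable R : nzRingType.

Lemma weakly_periodic_aug (G : groupType) :
  weakly_periodic (group_ring R G) -> weakly_periodic R.
Proof.
apply: (weakly_periodic_image (f := @aug R G)) => c.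
by exists (gr_const G c); exact: augK.
Qed.

Lemma weakly_periodic_gr_map (G H : groupType) (f : UMagmaMorphism.type G H) :
  (forall y, exists x, f x = y) ->
  weakly_periodic (group_ring R G) -> weakly_periodic (group_ring R H).
Proof.
move=> /choice[s sK]; apply: (weakly_periodic_image (f := @gr_map R G H f)) => v.
by exists (gr_map s v); rewrite /= gr_map_comp gr_map_id// => y _; exact: sK.
Qed.

(** If no positive power of [w] is 1, then [w ^+ m] occurs only as the leading term of the expansion
    of [(w - 1) ^+ m], with coefficient 1. *)
Lemma torsion_of_nilpotent (G : groupType) (w : G) :
  nilpotent_elt (gr_of R w - 1) -> exists2 n, (0 < n)%N & (w ^+ n = 1)%g.
Proof.
case=> m wm0; apply: contrapT => w_inf.
have := congr1 (mcoeff (w ^+ m)%g) wm0; rewrite mcoeff0.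
rewrite exprBn_comm; last exact: commr1.
rewrite raddf_sum big_ord_recl big1 => [|i _] /=.
  rewrite expr0 mul1r expr1n mulr1 subn0 bin0 -gr_ofX mcoeffUU addr0 => /eqP.
  by rewrite oner_eq0.
rewrite expr1n mulr1 -gr_ofX raddfMn -signr_odd /=.
suff c0 : (gr_of R (w ^+ (m - bump 0 i))%g)@_(w ^+ m)%g = 0.
  by case: odd; rewrite ?expr0 ?expr1 ?mulN1r ?mul1r ?mcoeffN c0 ?oppr0 mul0rn.
rewrite mcoeffU; case: eqP => // wE; case: w_inf; exists i.+1 => //.
apply: (mulgI (w ^+ (m - bump 0 i))%g).
by rewrite mulg1 -expgnDr subnK //= ltn_ord.
Qed.

Lemma torsion_central (G : groupType) (z : G) :
  weakly_periodic (group_ring R G) -> (forall x : G, commute z x) ->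
  exists2 n, (0 < n)%N & (z ^+ n = 1)%g.
Proof.
move=> wp zC; have ZC := gr_of_central (R := R) zC; set Z := gr_of R z in ZC.
have [e [q [[n n_gt1 en] q_nil ZE]]] := wp Z.
(* Centrality of [Z] makes [e = Z - q] commute with [q], which the decomposition alone does not
   provide. *)
have eE : e = Z - q by rewrite ZE addrK.
have Zn : nilpotent_elt (Z ^+ n - Z).
  have qe : GRing.comm q e.
    by rewrite eE; apply: commrB; [exact/commr_sym/ZC | exact: commr_refl].
  (* Since [Z - e = q] divides [Z ^+ n - e ^+ n], the whole is [q] times an element commuting with
     [q]. *)
  have -> : Z ^+ n - Z = (Z ^+ n - e ^+ n) - q.
    by rewrite en {2}ZE opprD addrA.
  rewrite subrXX_comm; last exact: ZC.
  have -> : Z - e = q by rewrite eE opprB addrC subrK.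
  rewrite -{2}[q]mulr1 -mulrBr; apply: nilpotent_commM => //.
  apply: commrB; last exact: commr1.
  apply: commr_sum => i _; apply: commrM; last exact: commrX.
  exact/commrX/commr_sym/ZC.
have [k k_gt0 zk] : exists2 k, (0 < k)%N & ((z ^+ n.-1) ^+ k = 1)%g.
  apply: torsion_of_nilpotent.
  have -> : gr_of R (z ^+ n.-1)%g - 1 = (Z ^+ n - Z) * gr_of R z^-1%g.
    rewrite mulrBl -gr_ofX -!gr_ofM mulgV gr_of1; congr (gr_of R _ - 1).
    by rewrite -{2}(ltn_predK n_gt1) expgSr mulgK.
  apply: nilpotent_commM => //; apply/commr_sym.
  by apply: commrB; [apply: commrX|]; exact/commr_sym/ZC.
by exists (n.-1 * k)%N; rewrite ?expgnA// muln_gt0 k_gt0 -subn1 subn_gt0 n_gt1.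
Qed.

(** A term of the series is central modulo the next one, so by [torsion_central] a positive power of
    each of its elements falls into the next term; torsion thus climbs to [G], the term of index
    0. *)
Lemma torsion_lower_central (G : groupType) n :
  weakly_periodic (group_ring R G) ->
  (forall x : G, lower_central n x -> exists2 m, (0 < m)%N & (x ^+ m = 1)%g) ->
  forall x : G, exists2 m, (0 < m)%N & (x ^+ m = 1)%g.
Proof.
move=> wp; elim: n => [|n IHn] tor; first by move=> x; exact: tor.
apply: IHn => x Lx.
have [Q [f [f_surj f_ker]]] := quotient_morphism
  (lower_central_subgroup G n.+1) (@lower_centralJ G n.+1).
have [|m m_gt0 fxm] := torsion_central (weakly_periodic_gr_map f_surj wp) (z := f x).
  move=> q; have [y <-] := f_surj q; apply/commgP; rewrite -gmulfR.
  by apply/eqP/f_ker => H _; apply; exists x, y.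
have [|k k_gt0 xmk] := tor (x ^+ m)%g.
  by apply/f_ker; rewrite gmulfXn.
by exists (m * k)%N; rewrite ?expgnA// muln_gt0 m_gt0.
Qed.

End NilpotentGroup.

Theorem theorem5p14 :
  (forall (p : nat) (R : nzRingType) (G : groupType),
     prime p -> weakly_periodic R -> nilpotent_elt (p%:R : R) ->
     locally_finite G -> p_group G p ->
     weakly_periodic (group_ring R G))
  /\
  (forall (R : nzRingType) (G : groupType),
     nilpotent_group G -> weakly_periodic (group_ring R G) ->
     weakly_periodic R /\ torsion_group G).
Proof.
split=> [p R G p_pr wpR p_nil G_lf G_p|R G [n Gn] wp].
  exact: (group_ring_weakly_periodic p_pr p_nil G_lf G_p).
split; first exact: weakly_periodic_aug wp.
move=> g; have [|m m_gt0 gm] := torsion_lower_central (n := n) wp _ g.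
  by move=> x /Gn ->; exists 1%N.
exact: has_order_torsion gm.
Qed.
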